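(* Fix a group $k\in\{1,2\}$. Let $\mathcal{D}$ be the current DAG on $V=\{1,\dots,q\}$ for this group, and let $\mathcal{D}'$ be a DAG obtained from $\mathcal{D}$ by reversing one edge $i\to j$ into $j\to i$, so that exactly the parent sets of nodes $i$ and $j$ change. Let $\mathcal{U}$ consist of the parameters attached to nodes $i$ and $j$, that is $\boldsymbol{L}_i,\boldsymbol{L}_j$ and those of $\sigma_i^2,\sigma_j^2$ whose index is at least $2$ (as $\sigma_1^2=1$ is fixed). Then the PAS acceptance probability of the move $\mathcal{D}\to\mathcal{D}'$ (defined in the context) is $$\alpha_{\mathcal{D}'}=\min\left\{1,\ \frac{m(\boldsymbol{X}_i\mid\boldsymbol{X}_{\mathrm{pa}_{\mathcal{D}'}(i)},\mathcal{D}')\,m(\boldsymbol{X}_j\mid\boldsymbol{X}_{\mathrm{pa}_{\mathcal{D}'}(j)},\mathcal{D}')}{m(\boldsymbol{X}_i\mid\boldsymbol{X}_{\mathrm{pa}_{\mathcal{D}}(i)},\mathcal{D})\,m(\boldsymbol{X}_j\mid\boldsymbol{X}_{\mathrm{pa}_{\mathcal{D}}(j)},\mathcal{D})}\cdot\frac{f(\mathcal{D}')}{f(\mathcal{D})}\cdot\frac{q(\mathcal{D}\mid\mathcal{D}')}{q(\mathcal{D}'\mid\mathcal{D})}\right\},$$ where, for a DAG $\mathcal{G}$ on $V$ and a node $s\ge2$, $$m(\boldsymbol{X}_s\mid\boldsymbol{X}_{\mathrm{pa}_{\mathcal{G}}(s)},\mathcal{G})=(2\pi)^{-\frac{n_k}{2}}\frac{|\boldsymbol{T}_s|^{1/2}}{|\bar{\boldsymbol{T}}_s|^{1/2}}\cdot\frac{\Gamma\left(\frac{a_s^{\mathcal{G}}}{2}+\frac{n_k}{2}\right)}{\Gamma\left(\frac{a_s^{\mathcal{G}}}{2}\right)}\left[\frac{g_k}{2}\right]^{a_s^{\mathcal{G}}/2}\left[\frac12\left(g_k+\boldsymbol{X}_s'\boldsymbol{X}_s-\hat{\boldsymbol{L}}_s'\bar{\boldsymbol{T}}_s\hat{\boldsymbol{L}}_s\right)\right]^{-(a_s^{\mathcal{G}}+n_k)/2},$$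 and for $s=1$, $$m(\boldsymbol{X}_1\mid\boldsymbol{X}_{\mathrm{pa}_{\mathcal{G}}(1)},\mathcal{G})=(2\pi)^{-\frac{n_k}{2}}\frac{|\boldsymbol{T}_1|^{1/2}}{|\bar{\boldsymbol{T}}_1|^{1/2}}\exp\left\{-\frac12\left(\boldsymbol{X}_1'\boldsymbol{X}_1-\hat{\boldsymbol{L}}_1'\bar{\boldsymbol{T}}_1\hat{\boldsymbol{L}}_1\right)\right\}.$$ Here, for the DAG $\mathcal{G}$ in question, $a_s^{\mathcal{G}}=a+|\mathrm{pa}_{\mathcal{G}}(s)|-q+1$, $\boldsymbol{T}_s=g_k\boldsymbol{I}_{|\mathrm{pa}_{\mathcal{G}}(s)|}$, $\bar{\boldsymbol{T}}_s=\boldsymbol{T}_s+\boldsymbol{X}_{\mathrm{pa}_{\mathcal{G}}(s)}'\boldsymbol{X}_{\mathrm{pa}_{\mathcal{G}}(s)}$ and $\hat{\boldsymbol{L}}_s=\bar{\boldsymbol{T}}_s^{-1}\boldsymbol{X}_{\mathrm{pa}_{\mathcal{G}}(s)}'\boldsymbol{X}_s$.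
   Context: Setting (for one group $k$, with superscripts $(k)$ suppressed). $q\ge 1$ is the number of nodes, $n_k\ge1$ the sample size, and $\boldsymbol{X}$ is a real $n_k\times q$ data matrix with columns $\boldsymbol{X}_1,\dots,\boldsymbol{X}_q$. For a DAG $\mathcal{G}$ on $V$, $\mathrm{pa}_{\mathcal{G}}(j)$ is the set of parents of $j$ and $\boldsymbol{X}_{\mathrm{pa}_{\mathcal{G}}(j)}$ is the submatrix of the corresponding columns. A prime on a matrix or vector denotes transpose (a prime on $\mathcal{D}$ is just a label). If a parent set is empty, determinants of $0\times0$ matrices are $1$ and the quadratic form $\hat{\boldsymbol{L}}_s'\bar{\boldsymbol{T}}_s\hat{\boldsymbol{L}}_s$ is $0$. Model. Given $\mathcal{G}$, the parameters are $\boldsymbol\theta=((\sigma_j^2)_{j},(\boldsymbol{L}_j)_{j})$ with $\sigma_1^2=1$ fixed, $\sigma_j^2>0$ and $\boldsymbol{L}_j\in\mathbb{R}^{|\mathrm{pa}_{\mathcal{G}}(j)|}$. The likelihood is $$f(\boldsymbol{X}\mid\boldsymbol\theta,\mathcal{G})=\prod_{j=1}^q f_{\mathcal{N}_{n_k}}\big(\boldsymbol{X}_j\mid-\boldsymbol{X}_{\mathrm{pa}_{\mathcal{G}}(j)}\boldsymbol{L}_j,\ \sigma_j^2\boldsymbol{I}_{n_k}\big),$$ where $f_{\mathcal{N}_n}(\cdot\mid\boldsymbol\mu,\boldsymbol\Sigma)$ is the $n$-variate normal density with mean $\boldsymbol\mu$ and covariance $\boldsymbol\Sigma$. Priors. Hyperparameters: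 $g_k>0$, $a>q-1$, $\xi\in(0,1)$. Given $\mathcal{G}$, independently over $j$: $\sigma_j^2\sim\mathrm{I\text{-}Ga}(a_j^{\mathcal{G}}/2,\,g_k/2)$ for $j\ge2$ (inverse gamma with shape and rate parameters), and $\boldsymbol{L}_j\mid\sigma_j^2\sim\mathcal{N}_{|\mathrm{pa}_{\mathcal{G}}(j)|}(\boldsymbol 0,\ g_k^{-1}\sigma_j^2\boldsymbol{I})$ for all $j$. The DAG prior is $f(\mathcal{G})\propto\xi^{|E|}(1-\xi)^{q(q-1)/2-|E|}$, where $|E|$ is the number of edges of $\mathcal{G}$. The proposal is $q(\mathcal{D}'\mid\mathcal{D})=1/|\mathbb{O}^{\mathcal{D}}|$, where $\mathbb{O}^{\mathcal{D}}$ is the set of single-edge insertions, deletions and reversals of $\mathcal{D}$ whose result is a DAG. PAS (partial analytic structure) acceptance probability. Let $\mathcal{U}$ be the parameters attached to the nodes whose parent sets differ between $\mathcal{D}$ and $\mathcal{D}'$, and let $\boldsymbol\theta_{-\mathcal{U}}$ be the remaining parameters, which have the same dimension under both DAGs and are given the same value under both. The acceptance probability is $\alpha_{\mathcal{D}'}=\min\{1,r\}$ with $$r=\frac{f(\mathcal{D}'\mid\boldsymbol\theta_{-\mathcal{U}},\boldsymbol{X})\,q(\mathcal{D}\mid\mathcal{D}')}{f(\mathcal{D}\mid\boldsymbol\theta_{-\mathcal{U}},\boldsymbol{X})\,q(\mathcal{D}'\mid\mathcal{D})},\qquad f(\mathcal{G}\mid\boldsymbol\theta_{-\mathcal{U}},\boldsymbol{X})\propto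 f(\mathcal{G})\int f(\boldsymbol{X}\mid\boldsymbol\theta,\mathcal{G})\,f(\boldsymbol\theta\mid\mathcal{G})\,d\boldsymbol\theta_{\mathcal{U}},$$ where the proportionality constant does not depend on $\mathcal{G}$. *)

(* Defs.v *)
From HB Require Import structures.
From mathcomp Require Import all_boot all_order all_algebra.
From mathcomp Require Import all_classical all_reals all_analysis.

Set Implicit Arguments.
Unset Strict Implicit.
Unset Printing Implicit Defensive.

Import Order.TTheory GRing.Theory Num.Theory.
Import numFieldNormedType.Exports.

Local Open Scope ring_scope.

Section power_measure.
Local Open Scope classical_set_scope.
Context d (T : measurableType d) (R : realType).

Definition cons_pair (p : nat) (u : T * p.-tuple T) : p.+1.-tuple T :=
  [the p.+1.-tuple T of u.1 :: u.2].

Lemma measurable_cons_pair (p : nat) :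
  measurable_fun [set: T * p.-tuple T] (@cons_pair p).
Proof. exact: measurable_cons. Qed.

Section cons_measure.
Variables (mu : {sigma_finite_measure set T -> \bar R}) (p : nat).
Variable nu : {sigma_finite_measure set (p.-tuple T) -> \bar R}.

Definition cons_measure : set (p.+1.-tuple T) -> \bar R :=
  pushforward (mu \x nu)%E (@cons_pair p).

Let cons_measure0 : cons_measure set0 = 0%E.
Proof. by rewrite /cons_measure /pushforward preimage_set0 measure0. Qed.

Let cons_measure_ge0 A : (0 <= cons_measure A)%E.
Proof. exact: (measure_ge0 (mu \x nu)%E). Qed.

Let cons_measure_sigma_additive : semi_sigma_additive cons_measure.
Proof.
move=> F mF tF mUF; rewrite /cons_measure /pushforward preimage_bigcup.
have mcons B : measurable B -> measurable (@cons_pair p @^-1` B).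
  by move=> mB; rewrite -[X in measurable X]setTI; exact: measurable_cons_pair.
apply: measure_semi_sigma_additive.
- by move=> k; exact: mcons.
- apply/trivIsetP => /= i j _ _ ij; rewrite -preimage_setI.
  by move/trivIsetP : tF => /(_ _ _ _ _ ij) ->//; rewrite preimage_set0.
- by rewrite -preimage_bigcup; exact: mcons.
Qed.

HB.instance Definition _ := isMeasure.Build _ _ _ cons_measure
  cons_measure0 cons_measure_ge0 cons_measure_sigma_additive.

Let cons_measure_sigma_finite : sigma_finite setT cons_measure.
Proof.
have /sigma_finiteP[F [FT ndF mF]] := sigma_finiteT mu.
have /sigma_finiteP[G [GT ndG mG]] := sigma_finiteT nu.
pose unc (t : p.+1.-tuple T) : T * p.-tuple T := (thead t, [tuple of behead t]).
have munc : measurable_fun setT unc.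
  by apply/measurable_fun_pair; [exact: measurable_tnth|exact: measurable_behead].
have uncK : cancel (@cons_pair p) unc.
  by case=> x t; rewrite /unc /cons_pair theadE; congr pair; apply/val_inj.
exists (fun k => unc @^-1` (F k `*` G k)).
  rewrite -preimage_bigcup (_ : \bigcup_k _ = setT) ?preimage_setT//.
  rewrite -setXTT FT GT predeqE => -[x y]; split.
    by move=> [n _ []/= ? ?]; split; exists n.
  move=> [/= [n _ Fnx] [k _ Gky]]; exists (maxn n k) => //; split.
  - by move: x Fnx; exact/subsetPset/ndF/leq_maxl.
  - by move: y Gky; exact/subsetPset/ndG/leq_maxr.
move=> k; have [mFk Fk] := mF k; have [mGk Gk] := mG k; split.
  by rewrite -[X in measurable X]setTI; apply: munc => //; exact: measurableX.
rewrite /cons_measure /pushforward -comp_preimage.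
rewrite (_ : unc \o _ = id); last by apply/funext => u /=; rewrite uncK.
by rewrite preimage_id product_measure1E// lte_mul_pinfty// ge0_fin_numE.
Qed.

HB.instance Definition _ := Measure_isSigmaFinite.Build _ _ _
  cons_measure cons_measure_sigma_finite.

End cons_measure.

Fixpoint power_measure (mu : {sigma_finite_measure set T -> \bar R}) (p : nat) :
    {sigma_finite_measure set (p.-tuple T) -> \bar R} :=
  match p with
  | 0 => dirac [tuple]
  | p'.+1 => cons_measure mu (power_measure mu p')
  end.

End power_measure.

Definition lebesgue_tuple (R : realType) (p : nat) :
    {sigma_finite_measure set (p.-tuple (measurableTypeR R)) -> \bar R} :=
  power_measure (@lebesgue_measure R) p.

Section densities.
Variable R : realType.
Local Open Scope classical_set_scope.

Definition gamma_fun (z : R) : R :=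
  \int[@lebesgue_measure R]_(t in `]0, +oo[) (t `^ (z - 1) * expR (- t)).

Definition inv_gamma_pdf (shape rate x : R) : R :=
  if 0 < x
  then rate `^ shape / gamma_fun shape * x `^ (- shape - 1) * expR (- (rate / x))
  else 0.

Definition mvnormal_pdf (p : nat) (mu : 'cV[R]_p) (Sigma : 'M[R]_p)
    (x : 'cV[R]_p) : R :=
  (2 * pi) `^ (- (p%:R / 2)) / Num.sqrt (\det Sigma) *
  expR (- (((x - mu)^T *m invmx Sigma *m (x - mu)) 0 0 / 2)).

End densities.

Section dag.
Variable q : nat.

(** A directed graph is its set of edges: [(u, v)] is the edge [u -> v].
    Node [k] of [{1, ..., q}] is the ordinal of value [k - 1]. *)
Definition digraph : finType := {set 'I_q * 'I_q}.
Implicit Types (G D : digraph) (s u v : 'I_q).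

Definition edge G : rel 'I_q := fun u v => (u, v) \in G.

(** No edge [u -> v] is closed into a directed cycle by a (possibly empty)
    directed path from [v] to [u]; in particular there is no loop. *)
Definition is_dag G : bool :=
  [forall u, forall v, edge G u v ==> ~~ connect (edge G) v u].

Definition pa G s : {set 'I_q} := [set u | edge G u s]%SET.

Definition first_node s : bool := (s : nat) == 0%N.

Definition insert_edge G u v : digraph := ((u, v) |: G)%SET.
Definition delete_edge G u v : digraph := (G :\ (u, v))%SET.
Definition reverse_edge G u v : digraph := ((v, u) |: G :\ (u, v))%SET.

(** Distinct admissible operations on a DAG give distinct DAGs, so the set of
    operations is identified with the set of their results. *)
Definition neighbours D : {set digraph} :=
  [set G : digraph | is_dag G &&
     [exists u, exists v,
        [|| ~~ edge D u v && (G == insert_edge D u v),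
            edge D u v && (G == delete_edge D u v) |
            edge D u v && (G == reverse_edge D u v)]]]%SET.

Definition changed_nodes D G : {set 'I_q} := [set s | pa D s != pa G s]%SET.

Lemma changed_nodes_reverse D u v : is_dag D -> edge D u v ->
  changed_nodes D (reverse_edge D u v) = [set u; v]%SET.
Proof.
move=> dagD Duv; have dag x y : edge D x y -> ~~ connect (edge D) y x.
  by move: dagD => /forallP/(_ x)/forallP/(_ y)/implyP.
have uv : u != v by apply: contraTneq (Duv) => <-; apply/negP=> /dag; rewrite connect0.
have Nvu : ~~ edge D v u.
  by apply: contraL (dag _ _ Duv) => vu; rewrite negbK; exact: connect1.
have paE s x : (x \in pa (reverse_edge D u v) s) =
    ((x, s) == (v, u)) || ((x, s) != (u, v)) && edge D x s.
  by rewrite !inE /edge !inE.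
apply/setP => s; rewrite !inE; have [->|su] := eqVneq s u.
  apply/eqP => /setP/(_ v); rewrite paE inE eqxx/=.
  by rewrite (negbTE Nvu).
have [->|sv] /= := eqVneq s v.
  apply/eqP => /setP/(_ u); rewrite paE inE Duv !xpair_eqE !eqxx/=.
  by rewrite (negbTE uv).
apply/negbTE; rewrite negbK; apply/eqP/setP => x.
by rewrite paE inE !xpair_eqE (negbTE su) (negbTE sv) !andbF.
Qed.

End dag.

Section dag_distributions.
Variables (R : realType) (q : nat).
Implicit Types G D : digraph q.

(** The truncated subtraction is exact on DAGs, which have at most
    [q * (q - 1) / 2] edges. *)
Definition dag_weight (xi : R) G : R :=
  xi ^+ #|G| * (1 - xi) ^+ ((q * q.-1)./2 - #|G|).

Definition dag_prior (xi : R) G : R :=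
  dag_weight xi G / \sum_(H : digraph q | is_dag H) dag_weight xi H.

(** [proposal G D] is the probability of proposing [G] from [D]. *)
Definition proposal G D : R :=
  if G \in neighbours D then #|neighbours D|%:R^-1 else 0.

End dag_distributions.

(** [coef theta s] is the vector [L_s], indexed by the parents of [s] in
    increasing order. *)
Record params (R : realType) (q : nat) (G : digraph q) := Params {
  sigma2 : 'I_q -> R ;
  coef : forall s : 'I_q, 'cV[R]_#|pa G s|
}.

Section model.
Variables (R : realType) (q n : nat) (X : 'M[R]_(n, q)) (g a : R).
Variable G : digraph q.
Implicit Types (theta : params R G) (s : 'I_q) (F : params R G -> \bar R).

Definition admissible theta : Prop :=
  forall s, 0 < sigma2 theta s /\ (first_node s -> sigma2 theta s = 1).

Definition parent_data s : 'M[R]_(n, #|pa G s|) :=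
  colsub (fun k : 'I_#|pa G s| => enum_val k) X.

Definition likelihood theta : R :=
  \prod_(s < q) mvnormal_pdf (- (parent_data s *m coef theta s))
                             (sigma2 theta s)%:M (col s X).

Definition ig_shape s : R := a + #|pa G s|%:R - q%:R + 1.

Definition params_prior theta : R :=
  (\prod_(s < q | ~~ first_node s)
      inv_gamma_pdf (ig_shape s / 2) (g / 2) (sigma2 theta s)) *
  \prod_(s < q) mvnormal_pdf 0 (g^-1 * sigma2 theta s)%:M (coef theta s).

Definition set_variance theta s (v : R) : params R G :=
  Params (fun t => if t == s then v else sigma2 theta t) (coef theta).

Definition set_coef theta s (l : 'cV[R]_#|pa G s|) : params R G :=
  Params (sigma2 theta)
    (@dfwith _ (fun t => 'cV[R]_#|pa G t|) (coef theta) s l).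

(** The variance of the first node is fixed, hence not integrated. *)
Definition int_variance s F theta : \bar R :=
  if first_node s then F theta
  else (\int[@lebesgue_measure R]_(v in [set` `]0%R, +oo[%R])
          F (set_variance theta s v))%E.

Definition int_coef s F theta : \bar R :=
  (\int[lebesgue_tuple R #|pa G s|]_l
     F (set_coef theta (\col_k tnth l k)%R))%E.

(** Integral over the parameters attached to the nodes in [U], the others being
    read in [theta]; it is iterated over the nodes, the order being immaterial
    by Tonelli's theorem as the integrand is nonnegative. *)
Definition int_params (U : {set 'I_q}) F : params R G -> \bar R :=
  foldr (fun s F' => int_variance s (int_coef s F')) F (enum U).

(** [c] stands for the proportionality constant, which does not depend on [G]. *)
Definition dag_posterior (xi c : R) (U : {set 'I_q}) theta : R :=
  c * (dag_prior xi G *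
       fine (int_params U (fun t => (likelihood t * params_prior t)%:E) theta)).

Definition T_mx s : 'M[R]_#|pa G s| := g%:M.

Definition Tbar_mx s : 'M[R]_#|pa G s| :=
  T_mx s + (parent_data s)^T *m parent_data s.

Definition Lhat s : 'cV[R]_#|pa G s| :=
  invmx (Tbar_mx s) *m (parent_data s)^T *m col s X.

Definition residual s : R :=
  ((col s X)^T *m col s X - (Lhat s)^T *m Tbar_mx s *m Lhat s) 0 0.

Definition node_marginal s : R :=
  (2 * pi) `^ (- (n%:R / 2)) *
  (Num.sqrt (\det (T_mx s)) / Num.sqrt (\det (Tbar_mx s))) *
  if first_node s then expR (- (residual s / 2))
  else gamma_fun (ig_shape s / 2 + n%:R / 2) / gamma_fun (ig_shape s / 2) *
       (g / 2) `^ (ig_shape s / 2) *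
       ((g + residual s) / 2) `^ (- ((ig_shape s + n%:R) / 2)).

End model.

Section pas.
Variables (R : realType) (q n : nat) (X : 'M[R]_(n, q)) (g a xi c : R).
Variables D D' : digraph q.

(** Outside [U] the two graphs have the same parent sets, so that the two
    coefficient vectors only differ by the cast between their types. *)
Definition same_outside (U : {set 'I_q}) (theta : params R D)
    (theta' : params R D') : Prop :=
  forall s, s \notin U ->
    sigma2 theta' s = sigma2 theta s /\
    forall e : #|pa D s| = #|pa D' s|,
      coef theta' s = castmx (e, erefl 1%N) (coef theta s).

(** [theta] and [theta'] only matter through their components outside
    [changed_nodes D D']. *)
Definition pas_acceptance (theta : params R D) (theta' : params R D') : R :=
  let U := changed_nodes D D' in
  Num.min 1
    ((dag_posterior X g a xi c U theta' * proposal R D D') /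
     (dag_posterior X g a xi c U theta * proposal R D' D)).

End pas.

(* Main.v *)
(** The joint density of data and parameters is a product over the nodes of factors,
    each of which only involves the parameters of its own node. Nodes other than [i]
    and [j] have the same parents, hence the same factor, in both graphs, and these
    positive factors cancel in the acceptance ratio. For [i] and [j], completing the square turns the integral over the coefficients into a
    Gaussian integral, computed one coordinate at a time through Schur complements;
    what remains is an inverse gamma kernel in the variance, integrated by the
    substitution [t = b / v] into the Gamma function. *)

Require Import Defs.
From mathcomp Require Import all_boot all_order all_algebra.
From mathcomp Require Import all_classical all_reals all_analysis measurable_realfun.
From mathcomp Require Import ring lra.

Set Implicit Arguments.
Unset Strict Implicit.
Unset Printing Implicit Defensive.

Import Order.TTheory GRing.Theory Num.Theory.
Import numFieldNormedType.Exports.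

Local Open Scope classical_set_scope.
Local Open Scope ring_scope.

(** * The Gamma function *)

Section gamma.
Variable R : realType.
Implicit Types (b r s x z : R) (f : R -> R).
Local Notation mu := (@lebesgue_measure R).

(** Compact intervals exhausting the half-line, away from the singularity at 0. Their reciprocal
    ends make [v -> b / v] carry [symm_itv 1 n] onto [symm_itv b n] for positive [b]. *)
Definition symm_itv r (n : nat) : set R := `[r / n.+1%:R, r * n.+1%:R].

Lemma symm_itv_gt0 r n x : 0 < r -> symm_itv r n x -> 0 < x.
Proof.
rewrite /symm_itv/= in_itv/= => r0 /andP[+ _]; apply: lt_le_trans.
by rewrite divr_gt0.
Qed.

Lemma bigcup_symm_itv r : 0 < r -> \bigcup_n symm_itv r n = [set` `]0, +oo[].
Proof.
move=> r0; apply/seteqP; split=> [x [n _]|x] /=.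
  by move=> /(symm_itv_gt0 r0); rewrite in_itv/= andbT.
rewrite in_itv/= andbT => x0.
(* Membership asks [n.+1] to be at least [r / x] and at least [x / r]; their sum bounds both. *)
exists (Num.truncn (r / x + x / r)) => //.
have h : r / x + x / r < (Num.truncn (r / x + x / r)).+1%:R by exact: Num.Theory.truncnS_gt.
have rx : 0 < r / x by rewrite divr_gt0.
have xr : 0 < x / r by rewrite divr_gt0.
rewrite /symm_itv /= in_itv /= ler_pdivrMr// -ler_pdivrMl// -ler_pdivrMl//.
by rewrite mulrC [_^-1 * x]mulrC; apply/andP; split; lra.
Qed.

(** Monotone convergence. It carries substitution and the fundamental theorem of calculus from
    compact intervals to improper integrals. *)
Lemma cvg_integral_symm_itv r f : 0 < r ->
  measurable_fun `](0:R), +oo[ f -> (forall x, 0 < x -> 0 <= f x) ->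
  (\int[mu]_(x in symm_itv r n) (f x)%:E)%E @[n --> \oo] -->
  (\int[mu]_(x in `]0%R, +oo[) (f x)%:E)%E.
Proof.
move=> r0 mf f0; rewrite -(bigcup_symm_itv r0).
apply: ge0_nondecreasing_set_cvg_integral.
- apply/nondecreasing_seqP => n; rewrite subsetEset => x; rewrite /symm_itv /= !in_itv/=.
  move=> /andP[h1 h2]; apply/andP; split.
    by apply: le_trans h1; rewrite ler_pM2l// lef_pV2 ?posrE// ler_nat.
  by apply: (le_trans h2); rewrite ler_pM2l// ler_nat.
- by move=> n; exact: measurable_itv.
- move=> n; apply/measurable_EFinP; apply: measurable_funS mf => //.
  by move=> x /(symm_itv_gt0 r0) x0; rewrite /= in_itv/= x0.
- by move=> n x /(symm_itv_gt0 r0) x0; rewrite lee_fin f0.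
Qed.

Lemma within_itv_continuous f a b : (forall x, a <= x -> {for x, continuous f}) ->
  {within `[a, b], continuous f}.
Proof.
move=> cf; apply/continuous_in_subspaceT => x; rewrite inE/= in_itv/=.
by move=> /andP[/cf].
Qed.

Lemma gt0_powRD x r s : 0 < x -> x `^ (r + s) = x `^ r * x `^ s.
Proof. by move=> x0; rewrite powRD// (gt_eqF x0) implybT. Qed.

Definition gamma_integrand z x : R := x `^ (z - 1) * expR (- x).

Lemma continuous_powR z x : 0 < x -> {for x, continuous (fun y : R => y `^ z)}.
Proof.
move=> x0; apply/differentiable_continuous/derivable1_diffP.
by apply: derivable_powR; rewrite in_itv/= x0.
Qed.

Lemma continuous_gamma_integrand z x : 0 < x ->
  {for x, continuous (gamma_integrand z)}.
Proof.
move=> x0; apply: cvgM; first exact: continuous_powR.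
apply: (cvg_comp (fun y : R => - y) expR); last exact: continuous_expR.
by apply: (@cvgN _ R^o); exact: cvg_id.
Qed.

Lemma measurable_gamma_integrand z : measurable_fun setT (gamma_integrand z).
Proof.
apply: measurable_funM.
  exact: measurable_powR.
by apply: measurableT_comp.
Qed.

Lemma gamma_integrand_ge0 z x : 0 <= gamma_integrand z x.
Proof. by rewrite mulr_ge0 ?powR_ge0 ?expR_ge0. Qed.

(** * The change of variable [x = b / v] *)

Lemma is_derive_hyperbola b x : 0 < x ->
  is_derive x 1 (fun v : R => b / v) (- (b / x ^+ 2)).
Proof.
move=> x0.
have -> : - (b / x ^+ 2) = b *: (- x ^- 2 *: (1 : R)).
  by rewrite /GRing.scale /= mulr1 mulrN.
have := @is_deriveV _ id x 1 1 (lt0r_neq0 x0) _.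
move=> /(_ (is_derive_id _ _)) h.
exact: (@is_deriveZ R R R^o (fun y => y^-1) b x 1 _ h).
Qed.

Lemma continuous_hyperbola b x : 0 < x -> {for x, continuous (fun v : R => b / v)}.
Proof.
move=> x0; apply/differentiable_continuous/derivable1_diffP.
by have [] := is_derive_hyperbola b x0.
Qed.

Lemma continuous_derive1_hyperbola b x : 0 < x ->
  {for x, continuous ((fun v : R => b / v)^`())%classic}.
Proof.
move=> x0.
rewrite /prop_for /continuous_at.
rewrite derive1E (@derive_val _ _ _ _ _ _ _ (is_derive_hyperbola b x0)).
have h : - (b / v ^+ 2) @[v --> x] --> - (b / x ^+ 2).
  apply: (@cvgN _ R^o); apply: cvgM; first exact: cvg_cst.
  apply: cvgV; first by rewrite expf_neq0// gt_eqF.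
  exact: exprn_continuous.
(* The closed form of the derivative is established at positive points only; these form a
   neighbourhood of [x]. *)
apply: cvg_trans h; apply: near_eq_cvg; near=> v.
rewrite derive1E.
have v0 : 0 < v by near: v; exact: lt_nbhsr.
by rewrite (@derive_val _ _ _ _ _ _ _ (is_derive_hyperbola b v0)).
Unshelve. all: by end_near. Qed.

(** The inverse gamma density of shape [z] and rate [b] on the half-line, without its normalising
    constant. *)
Definition inv_gamma_kernel z b (v : R) : R := v `^ (- z - 1) * expR (- (b / v)).

Lemma measurable_inv_gamma_kernel z b :
  measurable_fun `](0:R), +oo[ (inv_gamma_kernel z b).
Proof.
apply: open_continuous_measurable_fun => // x; rewrite inE/= in_itv/= andbT => x0.
apply: cvgM; first exact: continuous_powR.
apply: (cvg_comp (fun y : R => - (b / y)) expR); last exact: continuous_expR.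
by apply: (@cvgN _ R^o); exact: continuous_hyperbola.
Qed.

Lemma gamma_integral_substitution b z n : 0 < b ->
  (\int[mu]_(x in symm_itv b n) (gamma_integrand z x)%:E =
   \int[mu]_(v in symm_itv 1 n)
     (b `^ z * inv_gamma_kernel z b v)%:E)%E.
Proof.
move=> b0; pose F (v : R) := b / v.
have F1 : F (1 / n.+1%:R) = b * n.+1%:R by rewrite /F invf_div divr1.
have F2 : F (1 * n.+1%:R) = b / n.+1%:R by rewrite /F mul1r.
(* The map [F] is decreasing: the left end of the first interval is the image of the right end of
   the second, and conversely. *)
rewrite /symm_itv -F1 -F2.
have i0 : 0 < 1 / n.+1%:R :> R by rewrite divr_gt0.
have ab : 1 / n.+1%:R <= 1 * n.+1%:R :> R.
  by rewrite !mul1r (@le_trans _ _ 1)// ?ler1n// invf_le1// ler1n.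
have pos x : x \in `[1 / n.+1%:R, 1 * n.+1%:R] -> 0 < x.
  by rewrite in_itv/= => /andP[h _]; exact: lt_le_trans h.
have dF (x : R) : 0 < x -> derivable F x 1.
  by move=> x0; have [] := is_derive_hyperbola b x0.
have cF (x : R) : 0 < x -> {for x, continuous F}.
  by move=> x0; apply/differentiable_continuous/derivable1_diffP/dF.
rewrite integration_by_substitution_decreasing//.
- apply: eq_integral => v; rewrite inE => /pos v0; congr (_%:E).
  rewrite /= !fctE /= /F derive1E.
  rewrite (@derive_val _ _ _ _ _ _ _ (is_derive_hyperbola b v0)) opprK.
  rewrite /inv_gamma_kernel /gamma_integrand powRM ?invr_ge0 ?ltW//.
  rewrite -(powR_inv1 (ltW v0)) -powRrM.
  (* The powers are to combine as [(b / v)^(z - 1) * (b / v^2) = b^z * v^(- z - 1)]. *)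
  have -> : b / v ^+ 2 = b `^ 1 * v `^ (- 2).
    by rewrite powRr1 ?ltW// powR_invn ?ltW.
  have -> : b `^ z = b `^ (z - 1) * b `^ 1.
    by rewrite -gt0_powRD// subrK.
  have -> : v `^ (- z - 1) = v `^ (-1 * (z - 1)) * v `^ (- 2).
    by rewrite -gt0_powRD//; congr (_ `^ _); ring.
  ring.
- move=> x y /pos x0 /pos y0 xy.
  by rewrite /F ltr_pM2l// ltf_pV2.
- move=> x xi; apply: continuous_derive1_hyperbola; apply: pos.
  by apply: subset_itv_oo_cc.
- apply/cvg_ex; eexists; apply: cvg_at_right_filter.
  exact: continuous_derive1_hyperbola.
- apply/cvg_ex; eexists; apply: cvg_at_left_filter.
  by apply: continuous_derive1_hyperbola; rewrite mul1r.
- split.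
  + by move=> x xi; apply: dF; apply: pos; apply: subset_itv_oo_cc.
  + by apply: cvg_at_right_filter; exact: cF.
  + by apply: cvg_at_left_filter; apply: cF; rewrite mul1r.
- apply: within_itv_continuous => x; rewrite F2 => h; apply: continuous_gamma_integrand.
  by apply: lt_le_trans h; rewrite divr_gt0.
Qed.

(* [gamma_dominant z] is the derivative of [(x / (1 + x)) ^ z / z], which is bounded
   on the half-line. *)
Definition gamma_dominant z x : R := x `^ (z - 1) * (1 + x) `^ (- (z + 1)).

(** The base is [x / (1 + x)], written with a single occurrence of [x]; it visibly stays below 1. *)
Definition gamma_dominant_primitive z x : R := z^-1 * (1 - 1 / (1 + x)) `^ z.

(** From [expR y >= 1 + y] at [y = x / (z + 1)] one gets [1 + x <= (z + 1) * expR y]; raising this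
    to the power [z + 1] bounds [(1 + x)^(z + 1)] by a constant times [expR x]. *)
Lemma gamma_integrand_le z x : 0 < z -> 0 < x ->
  gamma_integrand z x <= (z + 1) `^ (z + 1) * gamma_dominant z x.
Proof.
move=> z0 x0; rewrite /gamma_integrand /gamma_dominant mulrCA.
have M0 : 0 < z + 1 by lra.
have x10 : 0 < 1 + x by lra.
rewrite ler_wpM2l ?powR_ge0// powRN expRN ler_pdivlMr ?powR_gt0//.
rewrite mulrC ler_pdivrMr ?expR_gt0//.
have -> : expR x = expR (x / (z + 1)) `^ (z + 1).
  by rewrite /powR gt_eqF ?expR_gt0// expRK mulrC divfK// gt_eqF.
rewrite -powRM ?expR_ge0 ?(ltW M0)//; apply: ge0_ler_powR; rewrite ?nnegrE.
- exact: ltW.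
- exact: ltW.
- by rewrite mulr_ge0 ?expR_ge0 ?ltW.
have := expR_ge1Dx (x / (z + 1)); rewrite -(ler_pM2l M0); apply: le_trans.
by rewrite mulrDr mulrCA divff ?mulr1 ?gt_eqF//; lra.
Qed.

Lemma is_derive_gamma_dominant_primitive z x : 0 < z -> 0 < x ->
  is_derive x 1 (gamma_dominant_primitive z) (gamma_dominant z x).
Proof.
move=> z0 x0; have x10 : 0 < 1 + x by lra.
have E : 1 - 1 / (1 + x) = x / (1 + x) by field; rewrite gt_eqF.
have p0 : 0 < 1 - 1 / (1 + x) by rewrite E divr_gt0.
have d1 : is_derive x 1 (fun y : R => 1 + y) 1.
  have := @is_deriveD R R R^o (cst 1) id x 1 0 1 (is_derive_cst _ _ _) (is_derive_id _ _).
  by rewrite add0r.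
have d2 : is_derive x 1 (fun y : R => (1 + y)^-1) (- (1 + x) ^- 2).
  have := @is_deriveV _ (fun y : R => 1 + y) x 1 1 (lt0r_neq0 x10) d1.
  by rewrite /GRing.scale /= mulr1.
have d3 : is_derive x 1 (fun y : R => 1 - 1 / (1 + y)) ((1 + x) ^- 2).
  have -> : (fun y : R => 1 - 1 / (1 + y)) = (fun y : R => 1 - (1 + y)^-1).
    by apply/funext => y; rewrite div1r.
  have := @is_deriveB R R R^o (cst 1) _ x 1 0 _ (is_derive_cst _ _ _) d2.
  by rewrite sub0r opprK.
have d4 := @is_derive1_powR R z _ p0.
have d5 := @is_derive1_comp _ (fun y => y `^ z) (fun y : R => 1 - 1 / (1 + y)) x _ _ d4 d3.
have d6 := @is_deriveZ R R R^o _ z^-1 x 1 _ d5.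
suff -> : gamma_dominant z x =
  z^-1 * (z * (1 - 1 / (1 + x)) `^ (z - 1) * (1 + x) ^- 2) by exact: d6.
apply/esym; rewrite E !mulrA mulVf ?gt_eqF// mul1r.
rewrite powRM ?invr_ge0 ?ltW// /gamma_dominant -mulrA; congr (_ * _).
rewrite -(powR_inv1 (ltW x10)) -powRrM -(powR_invn 2 (ltW x10)) -gt0_powRD//.
by congr (_ `^ _); ring.
Qed.

Lemma continuous_gamma_dominant z x : 0 < x -> {for x, continuous (gamma_dominant z)}.
Proof.
move=> x0; apply: cvgM; first exact: continuous_powR.
apply: (cvg_comp (fun y : R => 1 + y) (fun y => y `^ _)).
  by apply: (@cvgD _ R^o); [exact: cvg_cst|exact: cvg_id].
by apply: continuous_powR; lra.
Qed.

(** The dominating function has a primitive with values between 0 and [z^-1], so each compact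
    integral is at most [C / z], a bound that survives the limit. *)
Lemma gamma_integral_lty z : 0 < z ->
  (\int[mu]_(x in `]0%R, +oo[) (gamma_integrand z x)%:E < +oo)%E.
Proof.
move=> z0.
have h := @cvg_integral_symm_itv 1 (gamma_integrand z) ltr01
  (measurable_funTS (measurable_gamma_integrand z))
  (fun x _ => gamma_integrand_ge0 z x).
set C := (z + 1) `^ (z + 1).
apply: (@le_lt_trans _ _ (C * z^-1)%:E); last exact: ltry.
rewrite -(cvg_lim _ h)//; apply: lime_le; first by apply/cvg_ex; eexists; exact: h.
(* The interval of index 0 is a single point, whereas the fundamental theorem of calculus wants
   distinct ends. *)
exists 1%N => // n /= n1; rewrite /symm_itv.
have ab : 1 / n.+1%:R < 1 * n.+1%:R :> R.
  by rewrite !mul1r (@lt_trans _ _ 1)// ?invf_lt1// ?ltr1n.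
have a0 : 0 < 1 / n.+1%:R :> R by rewrite divr_gt0.
have pos x : 1 / n.+1%:R <= x -> 0 < x by exact: lt_le_trans.
apply: (@le_trans _ _
  (\int[mu]_(x in `[(1 / n.+1%:R)%R, (1 * n.+1%:R)%R]) (C * gamma_dominant z x)%:E)%E).
  apply: ge0_le_integral => //.
  - by move=> x _; rewrite lee_fin gamma_integrand_ge0.
  - apply/measurable_EFinP; apply: measurable_funTS.
    exact: measurable_gamma_integrand.
  - apply/measurable_EFinP; apply: measurable_funM => //.
    apply: subspace_continuous_measurable_fun => //.
    by apply: within_itv_continuous => x /pos; exact: continuous_gamma_dominant.
  - move=> x /=; rewrite in_itv/= => /andP[/pos x0 _].
    by rewrite lee_fin gamma_integrand_le.
have dF (x : R) : 0 < x -> is_derive x 1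
    (fun x => C * gamma_dominant_primitive z x) (C * gamma_dominant z x).
  move=> x0; apply: (@is_deriveZ R R R^o); exact: is_derive_gamma_dominant_primitive.
have cF (x : R) : 0 < x -> {for x, continuous (fun x => C * gamma_dominant_primitive z x)}.
  move=> /dF[? _]; exact/differentiable_continuous/derivable1_diffP.
have C0 : 0 <= C by exact: powR_ge0.
rewrite (@continuous_FTC2 _ _ (fun x => C * gamma_dominant_primitive z x))//.
- rewrite -EFinB lee_fin lerBlDr.
  apply: (@le_trans _ _ (C * z^-1)); last first.
    by rewrite lerDl mulr_ge0// mulr_ge0 ?powR_ge0// invr_ge0 ltW.
  rewrite ler_wpM2l// /gamma_dominant_primitive ler_piMr ?invr_ge0 ?(ltW z0)//.
  have u0 : 0 < 1 + 1 * n.+1%:R :> R by rewrite addr_gt0// mulr_gt0.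
  have u1 : 0 < 1 / (1 + 1 * n.+1%:R) :> R by rewrite divr_gt0.
  have u2 : 1 / (1 + 1 * n.+1%:R) <= 1 :> R.
    by rewrite ler_pdivrMr// !mul1r lerDl.
  apply: (@le_trans _ _ (1 `^ z)); last by rewrite powR1.
  apply: ge0_ler_powR; rewrite ?nnegrE ?(ltW z0)//.
  by rewrite subr_ge0.
- apply: within_itv_continuous => x /pos x0.
  by apply: cvgM; [exact: cvg_cst|exact: continuous_gamma_dominant].
- split.
  + move=> x; rewrite in_itv/= => /andP[/ltW/pos x0 _].
    by have [] := dF _ x0.
  + by apply: cvg_at_right_filter; exact: cF.
  + by apply: cvg_at_left_filter; apply: cF; rewrite mul1r.
- move=> x; rewrite in_itv/= => /andP[/ltW/pos x0 _].
  by rewrite derive1E; have [] := dF _ x0.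
Qed.

(** [gamma_fun] is a real integral, obtained through [fine], which sends infinite values to 0;
    finiteness makes it agree with the extended real integral. *)
Lemma gamma_integralE z : 0 < z ->
  (\int[mu]_(x in `]0%R, +oo[) (gamma_integrand z x)%:E = (gamma_fun z)%:E)%E.
Proof.
move=> z0; rewrite /gamma_fun /Rintegral fineK//.
rewrite ge0_fin_numE; first exact: gamma_integral_lty.
by apply: integral_ge0 => x _; rewrite lee_fin gamma_integrand_ge0.
Qed.

Lemma gamma_fun_gt0 z : 0 < z -> 0 < gamma_fun z.
Proof.
move=> z0; rewrite -lte_fin -gamma_integralE//.
(* A lower bound of the integrand on [[1, 2]]: there [0 <= ln x <= 1], so [x^(z - 1)] is at least
   [expR (- |z - 1|)], and [expR (- x)] is at least [expR (- 2)]. *)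
set c := expR (- `|z - 1| - 2).
apply: (@lt_le_trans _ _ (\int[mu]_(x in `[(1 : R)%R, (2 : R)%R]) c%:E)%E).
  rewrite integral_cst//= lebesgue_measure_itv/= lte_fin ltr1n -EFinB -EFinM lte_fin.
  by rewrite mulr_gt0 ?expR_gt0// subr_gt0 ltr1n.
apply: (@le_trans _ _ (\int[mu]_(x in `[(1 : R)%R, (2 : R)%R]) (gamma_integrand z x)%:E)%E).
  apply: ge0_le_integral => //.
  - by move=> x _; rewrite lee_fin expR_ge0.
  - apply/measurable_EFinP; apply: measurable_funTS.
    exact: measurable_gamma_integrand.
  - move=> x /=; rewrite in_itv/= => /andP[x1 x2]; rewrite lee_fin /c.
    have x0 : 0 < x by lra.
    rewrite /gamma_integrand /powR gt_eqF// -expRD ler_expR.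
    apply: lerD; last by rewrite lerN2.
    apply: lerNnormlW; rewrite normrM.
    have l0 : 0 <= ln x by rewrite ln_ge0.
    rewrite (ger0_norm l0) ler_piMr//.
    have := @le_ln1Dx R (x - 1); rewrite addrCA subrr addr0 => h.
    by apply: (le_trans (h _)); lra.
apply: ge0_subset_integral => //.
- apply/measurable_EFinP; apply: measurable_funTS.
  exact: measurable_gamma_integrand.
- by move=> x _; rewrite lee_fin gamma_integrand_ge0.
- by move=> x; rewrite /= !in_itv/= => /andP[x1 _]; rewrite andbT; lra.
Qed.

(** In the limit, the substitution shows that [gamma_fun z] is [b^z] times the integral sought. *)
Lemma integral_inv_gamma_kernel b z : 0 < b -> 0 < z ->
  (\int[mu]_(v in `]0%R, +oo[) (inv_gamma_kernel z b v)%:E =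
   (gamma_fun z * b `^ (- z))%:E)%E.
Proof.
move=> b0 z0.
have k0 v : 0 <= inv_gamma_kernel z b v by rewrite mulr_ge0 ?powR_ge0 ?expR_ge0.
have h1 := @cvg_integral_symm_itv b (gamma_integrand z) b0
  (measurable_funTS (measurable_gamma_integrand z))
  (fun x _ => gamma_integrand_ge0 z x).
have h2 := @cvg_integral_symm_itv 1 (fun v => b `^ z * inv_gamma_kernel z b v) ltr01 _ _.
have : (\int[mu]_(x in `]0%R, +oo[) (gamma_integrand z x)%:E =
  \int[mu]_(v in `]0%R, +oo[) (b `^ z * inv_gamma_kernel z b v)%:E)%E.
  rewrite -(cvg_lim _ h1)// -(cvg_lim _ (h2 _ _))//.
  - by congr (limn _); apply/funext => n; exact: gamma_integral_substitution.
  - by apply: measurable_funM => //; exact: measurable_inv_gamma_kernel.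
  - by move=> v _; rewrite mulr_ge0 ?powR_ge0.
rewrite gamma_integralE//.
under eq_integral do rewrite EFinM.
rewrite ge0_integralZl_EFin//; last 3 first.
- by move=> v _; rewrite lee_fin.
- by apply/measurable_EFinP; exact: measurable_inv_gamma_kernel.
- exact: powR_ge0.
move=> h; rewrite powRN mulrC EFinM h muleA -EFinM mulVf ?mul1e//.
by rewrite gt_eqF// powR_gt0.
Qed.
End gamma.

(** * Gaussian integrals *)

Section gaussian_integral.
Variable R : realType.
Local Notation mu := (@lebesgue_measure R).
Local Notation tR p := (p.-tuple (measurableTypeR R)).

(** The measure is a Dirac mass on a one-point space, where every preimage is empty or full, so that
    every function is measurable. *)
Lemma integral_lebesgue_tuple0 (f : tR 0 -> \bar R) :
  (\int[lebesgue_tuple R 0]_t f t = f [tuple])%E.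
Proof.
rewrite /lebesgue_tuple/= integral_dirac//; first by rewrite diracT mul1e.
move=> _ Y mY; have [h|h] := pselect (Y (f [tuple])).
  rewrite (_ : _ `&` _ = setT)//; apply/seteqP; split=> // t _.
  by rewrite tuple0; split.
rewrite (_ : _ `&` _ = set0)//; apply/seteqP; split=> // t [_ /=].
by rewrite tuple0.
Qed.

(** The measure is the pushforward of a product along [cons_pair]; Tonelli's theorem leaves the head
    as the outer variable. *)
Lemma integral_lebesgue_tupleS p (f : tR p.+1 -> \bar R) :
  measurable_fun setT f -> (forall t, 0 <= f t)%E ->
  (\int[lebesgue_tuple R p.+1]_t f t =
   \int[mu]_x \int[lebesgue_tuple R p]_t f [the tR p.+1 of x :: t])%E.
Proof.
move=> mf f0; rewrite /lebesgue_tuple/=.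
rewrite (@ge0_integral_pushforward _ _ _ _ _ _ (measurable_cons_pair (p := p)))//.
rewrite preimage_setT fubini_tonelli1//; last by move=> x; exact: f0.
exact: (measurableT_comp mf (measurable_cons_pair (p := p))).
Qed.

(** The normal density of mean [m] and variance [s^-1] has mass 1, and its peak is the inverse of
    the right-hand side. *)
Lemma integral_gauss1 (s m : R) : 0 < s ->
  (\int[mu]_x (expR (- (s * (x - m) ^+ 2 / 2)))%:E = (Num.sqrt (2 * pi / s))%:E)%E.
Proof.
move=> s0; pose sg := Num.sqrt s^-1.
have sg0 : sg != 0 by rewrite gt_eqF// sqrtr_gt0 invr_gt0.
have sgE : sg ^+ 2 = s^-1 by rewrite sqr_sqrtr// invr_ge0 ltW.
have pk : normal_peak sg = (Num.sqrt (2 * pi / s))^-1.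
  by rewrite /normal_peak sgE; congr (Num.sqrt _)^-1; rewrite -mulr_natl; ring.
have := integral_normal_pdf m sg; rewrite normal_pdfE// /normal_fun sgE.
under eq_integral do rewrite EFinM.
rewrite ge0_integralZl_EFin//; last 2 first.
- by apply/measurable_EFinP; have := measurable_normal_fun m sg; rewrite /normal_fun sgE.
- exact: normal_peak_ge0.
rewrite pk => h.
have p0 : 0 < Num.sqrt (2 * pi / s) by rewrite sqrtr_gt0 divr_gt0// mulr_gt0// pi_gt0.
transitivity ((Num.sqrt (2 * pi / s))%:E *
  ((Num.sqrt (2 * pi / s))^-1%:E * (\int[mu]_x (expR (- (x - m) ^+ 2 / (s^-1 *+ 2)))%:E)))%E.
  rewrite muleA -EFinM mulfV ?gt_eqF// mul1e; apply: eq_integral => x _.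
  congr (expR _)%:E; field; rewrite gt_eqF//.
by rewrite h mule1.
Qed.

(** * Quadratic forms and positive definite matrices *)

Definition quad_form p (A : 'M[R]_p) (v : 'cV[R]_p) : R := (v^T *m A *m v) 0 0.

Definition posdef p (A : 'M[R]_p) : Prop :=
  A^T = A /\ forall v, v != 0 -> 0 < quad_form A v.

Definition col_of_tuple p (t : tR p) : 'cV[R]_p := \col_k tnth t k.

Lemma measurable_quad_form p (A : 'M[R]_p) m :
  measurable_fun setT (fun t : tR p => quad_form A (col_of_tuple t - m)).
Proof.
have -> : (fun t : tR p => quad_form A (col_of_tuple t - m)) =
    (fun t => \sum_j (\sum_i (tnth t i - m i 0) * A i j) * (tnth t j - m j 0)).
  apply/funext => t; rewrite /quad_form mxE; apply: eq_bigr => j _; rewrite !mxE.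
  by congr (_ * _); apply: eq_bigr => i _; rewrite !mxE.
have mt i : measurable_fun setT (fun t : tR p => tnth t i - m i 0).
  by apply: measurable_funB => //; exact: measurable_tnth.
apply: measurable_sum => j; apply: measurable_funM => //.
by apply: measurable_sum => i; apply: measurable_funM.
Qed.

Lemma quad_form_congr p r (L : 'M[R]_(p, r)) (M : 'M[R]_p) x :
  quad_form (L^T *m M *m L) x = quad_form M (L *m x).
Proof. by rewrite /quad_form trmx_mul !mulmxA. Qed.

Lemma quad_form_block p (s : R) (M : 'M[R]_p) (u : 'cV[R]_1) t :
  quad_form (block_mx s%:M 0 0 M) (col_mx u t) = s * u 0 0 ^+ 2 + quad_form M t.
Proof.
rewrite /quad_form tr_col_mx mul_row_block !mulmx0 addr0 add0r mul_row_col mxE.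
by congr (_ + _); rewrite mul_mx_scalar -scalemxAl mxE mxE big_ord1 mxE.
Qed.

Lemma measurable_gauss p (A : 'M[R]_p) m :
  measurable_fun setT (fun t : tR p =>
    expR (- (quad_form A (col_of_tuple t - m) / 2))).
Proof.
apply: measurableT_comp => //; apply: measurableT_comp => //.
by apply: measurable_funM => //; exact: measurable_quad_form.
Qed.

Lemma quad_form1E m (v : 'cV[R]_m) : quad_form 1%:M v = \sum_i v i 0 ^+ 2.
Proof.
by rewrite /quad_form mulmx1 mxE; apply: eq_bigr => i _; rewrite !mxE expr2.
Qed.

Lemma quad_form1_ge0 m (v : 'cV[R]_m) : 0 <= quad_form 1%:M v.
Proof. by rewrite quad_form1E sumr_ge0// => i _; exact: sqr_ge0. Qed.

Lemma quad_formZ m c (A : 'M[R]_m) v : quad_form (c *: A) v = c * quad_form A v.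
Proof. by rewrite /quad_form -scalemxAr -scalemxAl mxE. Qed.

Lemma posdefZ m c (A : 'M[R]_m) : 0 < c -> posdef A -> posdef (c *: A).
Proof.
move=> c0 [sA pA]; split; first by rewrite linearZ/= sA.
by move=> v v0; rewrite quad_formZ mulr_gt0// pA.
Qed.

Lemma posdef1 m : posdef (1%:M : 'M[R]_m).
Proof.
split=> [|v v0]; first exact: trmx1.
rewrite lt_neqAle quad_form1_ge0 andbT eq_sym; apply: contra v0.
rewrite quad_form1E psumr_eq0; last by move=> i _; exact: sqr_ge0.
move=> /allP h; apply/eqP/colP => i; rewrite mxE; apply/eqP.
by have := h i (mem_index_enum _); rewrite sqrf_eq0.
Qed.

(** * Splitting off the first coordinate by a Schur complement *)

Section schur.
Variables (p : nat) (A : 'M[R]_(1 + p)).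
Hypothesis A_posdef : posdef A.
Let B := drsubmx A.
Let v : 'cV[R]_p := dlsubmx A.
Let w := invmx B *m v.
Let s := (ulsubmx A - v^T *m w) 0 0.

Let symA : A^T = A. Proof. by case: A_posdef. Qed.
Let symB : B^T = B. Proof. by rewrite /B trmx_drsub symA. Qed.
Let urA : ursubmx A = v^T. Proof. by rewrite /v trmx_dlsub symA. Qed.

(** The form of [B] is that of [A] restricted to vectors with first coordinate 0. *)
Lemma posdef_drsub : posdef B.
Proof.
split=> // t t0; have [_ /(_ (col_mx 0 t))] := A_posdef.
rewrite /quad_form -[A]submxK tr_col_mx trmx0 mul_row_block mul_row_col.
rewrite !mul0mx !mulmx0 !add0r; apply; apply: contra t0 => /eqP.
by rewrite -[X in _ = X]col_mx0 => /eq_col_mx[_ ->].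
Qed.

Hypothesis Bunit : B \in unitmx.

Let Bw : B *m w = v. Proof. by rewrite /w mulKVmx. Qed.
Let wB : w^T *m B = v^T. Proof. by rewrite -[in RHS]Bw [in RHS]trmx_mul symB. Qed.

(* [s] is the Schur complement of [B]; the scalar block is split off so that the first
   coordinate of a tuple is integrated last. *)
Lemma posdef_schurE :
  A = block_mx 1%:M w^T 0 1%:M *m block_mx s%:M 0 0 B *m block_mx 1%:M 0 w 1%:M.
Proof.
rewrite !mulmx_block !mul1mx !mul0mx !mulmx0 !mulmx1 !add0r !addr0 wB Bw.
rewrite -[LHS]submxK urA; congr block_mx.
by rewrite -[s%:M]mx11_scalar subrK.
Qed.

(** The outer factors of the decomposition are unitriangular, of determinant 1. *)
Lemma det_schur : \det A = s * \det B.
Proof.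
rewrite [in LHS]posdef_schurE !det_mulmx !(det_ublock, det_lblock).
by rewrite !det1 det_scalar1 !mulr1 !mul1r.
Qed.

(** The decomposition is a congruence by the shear taking [(u, t)] to [(u, t + w u)]. *)
Lemma quad_form_schur (u : 'cV[R]_1) t :
  quad_form A (col_mx u t) = s * u 0 0 ^+ 2 + quad_form B (t + w *m u).
Proof.
rewrite [in LHS]posdef_schurE.
have -> : block_mx 1%:M w^T 0 1%:M = (block_mx (1%:M : 'M[R]_1) 0 w 1%:M)^T.
  by rewrite tr_block_mx trmx0 !trmx1.
rewrite quad_form_congr mul_block_col !mul1mx mul0mx addr0 quad_form_block.
by rewrite (addrC t).
Qed.

Lemma schur_gt0 : 0 < s.
Proof.
(* The shear sends this vector to [(1, 0)], where the form takes the value [s]. *)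
have [_ /(_ (col_mx 1%:M (- w)))] := A_posdef.
rewrite quad_form_schur mulmx1 addNr /quad_form mulmx0 !mxE eqxx expr1n mulr1 addr0; apply.
apply/eqP; rewrite -[X in _ = X]col_mx0 => /eq_col_mx[/matrixP/(_ 0 0)].
by rewrite !mxE eqxx => /eqP; rewrite oner_eq0.
Qed.

End schur.

(** Induction on the dimension: the determinant is the product of the Schur complement and of the
    determinant of a smaller positive definite block. *)
Lemma posdef_det_gt0 p (A : 'M[R]_p) : posdef A -> 0 < \det A.
Proof.
elim: p A => [|p IH] A posA; first by rewrite det_mx00.
have dB := IH _ (posdef_drsub posA).
have uB : @drsubmx R 1 p 1 p A \in unitmx by rewrite unitmxE unitfE gt_eqF.
by rewrite (det_schur posA uB) mulr_gt0// schur_gt0.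
Qed.

(** Induction on the dimension. Fixing the first coordinate only moves the centre of the inner
    Gaussian, so the inner integral is constant and a Gaussian of precision [s] in one variable
    remains. *)
Lemma integral_gauss p (A : 'M[R]_p) m : posdef A ->
  (\int[lebesgue_tuple R p]_t (expR (- (quad_form A (col_of_tuple t - m) / 2)))%:E =
   ((2 * pi) `^ (p%:R / 2) / Num.sqrt (\det A))%:E)%E.
Proof.
elim: p A m => [|p IH] A m posA.
  rewrite integral_lebesgue_tuple0.
  have -> v : quad_form A v = 0 by rewrite /quad_form (flatmx0 v) mulmx0 mxE.
  by rewrite !mul0r oppr0 expR0 det_mx00 sqrtr1 powRr0 divr1.
have dB := posdef_det_gt0 (posdef_drsub posA).
have uB : @drsubmx R 1 p 1 p A \in unitmx by rewrite unitmxE unitfE gt_eqF.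
rewrite integral_lebesgue_tupleS; last 2 first.
- by apply/measurable_EFinP; exact: measurable_gauss.
- by move=> t; rewrite lee_fin expR_ge0.
pose B := @drsubmx R 1 p 1 p A; pose w := invmx B *m @dlsubmx R 1 p 1 p A.
pose s := (@ulsubmx R 1 p 1 p A - (@dlsubmx R 1 p 1 p A)^T *m w) 0 0.
pose m1 := @usubmx R 1 p 1 m 0 0; pose m2 := @dsubmx R 1 p 1 m.
have s0 : 0 < s by exact: schur_gt0.
have colE x (t : tR p) : col_of_tuple [the tR p.+1 of x :: t] - m =
    col_mx (x - m1)%:M (col_of_tuple t - m2) :> 'cV[R]_(1 + p).
  apply/colP => k; rewrite -(fintype.splitK k); case: (fintype.split k) => k' /=.
    by rewrite col_mxEu /m1 !mxE ord1 (tnth_nth x) eqxx mulr1n.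
  by rewrite col_mxEd !mxE (tnth_nth x) /= (tnth_nth x).
have quadE x (t : tR p) :
    expR (- (quad_form A (col_of_tuple [the tR p.+1 of x :: t] - m) / 2)) =
    expR (- (s * (x - m1) ^+ 2 / 2)) *
    expR (- (quad_form B (col_of_tuple t - (m2 - w *m (x - m1)%:M)) / 2)).
  rewrite colE (quad_form_schur posA uB) -/B -/w -/s mxE eqxx mulr1n.
  by rewrite opprB addrCA [w *m _ + _]addrC -expRD mulrDl opprD.
(* The value of the inner integral; the induction hypothesis covers every centre, so it does not
   depend on [x]. *)
pose K := (2 * pi) `^ (p%:R / 2) / Num.sqrt (\det B).
have K0 : 0 <= K by rewrite mulr_ge0 ?powR_ge0// invr_ge0 sqrtr_ge0.
transitivity (\int[mu]_x (K%:E * (expR (- (s * (x - m1) ^+ 2 / 2)))%:E))%E.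
  apply: eq_integral => x _.
  under eq_integral => t _.
    rewrite quadE EFinM; over.
  rewrite ge0_integralZl_EFin; last 4 first.
  - by [].
  - by move=> t _; rewrite lee_fin expR_ge0.
  - by apply/measurable_EFinP; exact: measurable_gauss.
  - exact: expR_ge0.
  by rewrite IH; [rewrite muleC|exact: posdef_drsub].
rewrite ge0_integralZl_EFin//; last first.
- apply/measurable_EFinP; apply: measurableT_comp => //; apply: measurableT_comp => //.
  apply: measurable_funM => //; apply: measurable_funM => //.
  by apply: measurable_funX; exact: measurable_funB.
rewrite integral_gauss1// -EFinM (det_schur posA uB) -/B -/w -/s; congr (_%:E).
have pp : 0 < 2 * pi :> R by rewrite mulr_gt0// pi_gt0.
rewrite /K -(natr1 p) [(p%:R + 1) / 2]mulrDl [1 / 2]mul1r gt0_powRD// powR12_sqrt ?(ltW pp)//.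
rewrite sqrtrM ?(ltW pp)// sqrtrV ?(ltW s0)// [Num.sqrt (s * _)]sqrtrM ?(ltW s0)// invfM.
by rewrite /K; ring.
Qed.
Lemma mvnormal_pdf_scalar m (mean y : 'cV[R]_m) v : 0 < v ->
  mvnormal_pdf mean v%:M y = (2 * pi) `^ (- (m%:R / 2)) / Num.sqrt (v ^+ m) *
    expR (- (v^-1 * quad_form 1%:M (y - mean) / 2)).
Proof.
move=> v0; rewrite /mvnormal_pdf det_scalar invmx_scalar.
by rewrite -quad_formZ scalemx1.
Qed.

Lemma sqrt_expr (v : R) m : 0 < v -> Num.sqrt (v ^+ m) = v `^ (m%:R / 2).
Proof.
by move=> v0; rewrite powRrM powR12_sqrt ?powR_ge0// powR_mulrn// ltW.
Qed.

End gaussian_integral.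

(** * Node factors and their integrals *)

Section node_integral.
Variables (R : realType) (n p : nat) (P : 'M[R]_(n, p)) (x : 'cV[R]_n) (g : R).
Hypothesis g_gt0 : 0 < g.
Let Tb : 'M[R]_p := g%:M + P^T *m P.
Let Lh : 'cV[R]_p := invmx Tb *m P^T *m x.
Let res : R := (x^T *m x - Lh^T *m Tb *m Lh) 0 0.

(** The form is [g |v|^2 + |P v|^2], whose first term is positive for nonzero [v]. *)
Lemma posdef_ridge : posdef Tb.
Proof.
split; first by rewrite linearD /= tr_scalar_mx trmx_mul trmxK.
move=> v v0; have -> : quad_form Tb v = g * quad_form 1%:M v + quad_form 1%:M (P *m v).
  rewrite -quad_formZ scalemx1 -quad_form_congr mulmx1 /quad_form /Tb.
  by rewrite mulmxDr mulmxDl mxE.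
by rewrite ltr_pwDl ?quad_form1_ge0// mulr_gt0//; apply: (posdef1 R p).2.
Qed.

Lemma ridge_unit : Tb \in unitmx.
Proof. by rewrite unitmxE unitfE gt_eqF// posdef_det_gt0//; exact: posdef_ridge. Qed.

(** [Lh] solves the normal equations [Tb Lh = P^T x]. The column has mean [- P l], whence the
    deviation [x + P l] and the centre [- Lh]. *)
Lemma complete_square l : quad_form 1%:M (x + P *m l) + g * quad_form 1%:M l =
  quad_form Tb (l + Lh) + res.
Proof.
have TL : Tb *m Lh = P^T *m x by rewrite /Lh -mulmxA mulKVmx// ridge_unit.
have LT : Lh^T *m Tb = x^T *m P.
  by rewrite -{1}(posdef_ridge.1) -[LHS]trmxK [(Lh^T *m _)^T]trmx_mul !trmxK TL trmx_mul trmxK.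
have D (M N : 'M[R]_1) : (M + N) 0 0 = M 0 0 + N 0 0 by rewrite mxE.
have N (M : 'M[R]_1) : (- M) 0 0 = - M 0 0 by rewrite mxE.
rewrite -quad_formZ scalemx1 /quad_form /res.
have -> : (x + P *m l)^T *m 1%:M *m (x + P *m l) = x^T *m x + x^T *m P *m l +
    (l^T *m P^T *m x + l^T *m P^T *m P *m l).
  by rewrite mulmx1 [(x + _)^T]linearD/= trmx_mul mulmxDl !mulmxDr !mulmxA.
have G (M : 'M[R]_p) (b : 'cV[R]_p) : (l + b)^T *m M *m (l + b) =
    l^T *m M *m l + l^T *m (M *m b) + (b^T *m M *m l + b^T *m M *m b).
  by rewrite [(l + _)^T]linearD/= !mulmxDl !mulmxDr !mulmxA.
have -> : (l + Lh)^T *m Tb *m (l + Lh) = l^T *m Tb *m l + l^T *m P^T *m x +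
    (x^T *m P *m l + Lh^T *m Tb *m Lh).
  by rewrite G TL LT mulmxA.
have -> : l^T *m Tb *m l = l^T *m g%:M *m l + l^T *m P^T *m P *m l.
  by rewrite /Tb mulmxDr mulmxDl !mulmxA.
by rewrite !D N; ring.
Qed.

(** At [l = - Lh] the completed square vanishes, and [res] is a sum of nonnegative terms. *)
Lemma ridge_residual_ge0 : 0 <= res.
Proof.
have q0 : quad_form Tb 0 = 0 by rewrite /quad_form mulmx0 mxE.
have := complete_square (- Lh); rewrite addNr q0 add0r => <-.
by rewrite addr_ge0 ?quad_form1_ge0// mulr_ge0 ?quad_form1_ge0// ltW.
Qed.

(** The part of the product of the two densities that does not depend on [l]. *)
Definition ridge_const v : R := (2 * pi) `^ (- (n%:R / 2)) / Num.sqrt (v ^+ n) *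
  ((2 * pi) `^ (- (p%:R / 2)) / Num.sqrt ((g^-1 * v) ^+ p)) * expR (- (res / 2 / v)).

(** As a function of [l], the product is a Gaussian kernel of precision [Tb / v] centred at [- Lh]:
    the conjugate posterior of the coefficients. *)
Lemma ridge_densityE v l : 0 < v ->
  mvnormal_pdf (- (P *m l)) v%:M x * mvnormal_pdf 0 (g^-1 * v)%:M l =
  ridge_const v * expR (- (quad_form (v^-1 *: Tb) (l - - Lh) / 2)).
Proof.
move=> v0; have gv0 : 0 < g^-1 * v by rewrite mulr_gt0// invr_gt0.
rewrite !mvnormal_pdf_scalar// mulrACA /ridge_const -!mulrA.
congr (_ * (_ * (_ * (_ * _)))).
rewrite -!expRD; congr expR; rewrite subr0 !opprK.
have := complete_square l; rewrite quad_formZ => E.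
set Q1 := quad_form _ _ in E *; set Q2 := quad_form _ _ in E *.
have -> : quad_form Tb (l + Lh) = Q1 + g * Q2 - res by rewrite E addrK.
by field; rewrite !gt_eqF.
Qed.

Lemma measurable_ridge_density v : 0 < v ->
  measurable_fun setT (fun t : p.-tuple (measurableTypeR R) =>
    mvnormal_pdf (- (P *m col_of_tuple t)) v%:M x *
    mvnormal_pdf 0 (g^-1 * v)%:M (col_of_tuple t)).
Proof.
move=> v0; under eq_fun do rewrite ridge_densityE//.
by apply: measurable_funM => //; exact: measurable_gauss.
Qed.

(** The power of [v] in the determinant of [v^-1 *: Tb] cancels the one in the normalisation of the
    prior, whose power of [g] becomes the determinant of [g%:M]. *)
Lemma integral_ridge v : 0 < v ->
  (\int[lebesgue_tuple R p]_l
     (mvnormal_pdf (- (P *m col_of_tuple l)) v%:M x *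
      mvnormal_pdf 0 (g^-1 * v)%:M (col_of_tuple l))%:E =
   ((2 * pi) `^ (- (n%:R / 2)) *
    (Num.sqrt (\det (g%:M : 'M[R]_p)) / Num.sqrt (\det Tb)) *
    (v `^ (- (n%:R / 2)) * expR (- (res / 2 / v))))%:E)%E.
Proof.
move=> v0.
have gv0 : 0 < g^-1 * v by rewrite mulr_gt0// invr_gt0.
have vi0 : 0 < v^-1 by rewrite invr_gt0.
have pp : 0 < 2 * pi :> R by rewrite mulr_gt0// pi_gt0.
have K0 : 0 <= ridge_const v.
  by rewrite !mulr_ge0 ?powR_ge0 ?invr_ge0 ?sqrtr_ge0 ?expR_ge0.
under eq_integral do rewrite ridge_densityE// EFinM.
rewrite ge0_integralZl_EFin//; last by apply/measurable_EFinP; exact: measurable_gauss.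
rewrite integral_gauss; last by apply: posdefZ => //; exact: posdef_ridge.
rewrite -EFinM; congr (_%:E).
(* With the square roots as nonzero atoms, the identity becomes one between rational fractions. *)
have sT0 : 0 < Num.sqrt (\det Tb).
  by rewrite sqrtr_gt0 posdef_det_gt0//; exact: posdef_ridge.
have sv0 : 0 < Num.sqrt (v ^+ p) by rewrite sqrtr_gt0 exprn_gt0.
have sg0 : 0 < Num.sqrt (g ^+ p) by rewrite sqrtr_gt0 exprn_gt0.
have sn0 : 0 < Num.sqrt (v ^+ n) by rewrite sqrtr_gt0 exprn_gt0.
have tp0 : 0 < (2 * pi : R) `^ (p%:R / 2) by rewrite powR_gt0.
rewrite /ridge_const detZ det_scalar (powRN _ (p%:R / 2)) (powRN v) -(sqrt_expr n v0).
rewrite [Num.sqrt (v^-1 ^+ p * _)]sqrtrM ?exprn_ge0 ?(ltW vi0)//.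
rewrite exprVn sqrtrV ?exprn_ge0 ?(ltW v0)//.
rewrite exprMn exprVn [Num.sqrt (_^-1 * _)]sqrtrM ?invr_ge0 ?exprn_ge0 ?(ltW g_gt0)//.
rewrite sqrtrV ?exprn_ge0 ?(ltW g_gt0)//.
by field; rewrite !gt_eqF.
Qed.
End node_integral.

(** * The factor of one node in the joint density *)

Section node_factor.
Variables (R : realType) (q n : nat) (X : 'M[R]_(n, q)) (g a : R).
Hypothesis g_gt0 : 0 < g.
Hypothesis a_gt : q%:R - 1 < a.
Implicit Types (s : 'I_q) (A : {set 'I_q}) (G : digraph q).
Local Notation mu := (@lebesgue_measure R).

(* The parent set is a variable here, and not [pa G s], so that factors taken in two
   graphs giving [s] the same parents can be identified without casts. *)
Definition node_factor s A (v : R) (l : 'cV[R]_#|A|) : R :=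
  mvnormal_pdf (- (colsub (fun k : 'I_#|A| => enum_val k) X *m l)) v%:M (col s X) *
  mvnormal_pdf 0 (g^-1 * v)%:M l *
  (if first_node s then 1
   else inv_gamma_pdf ((a + #|A|%:R - q%:R + 1) / 2) (g / 2) v).

(** Substituting the equality of the parent sets turns the cast into the identity. *)
Lemma node_factor_castmx s A A' v v' (l : 'cV[R]_#|A|) (l' : 'cV[R]_#|A'|) :
  A = A' -> v = v' ->
  (forall e : #|A| = #|A'|, l' = castmx (e, erefl 1%N) l) ->
  node_factor s v' l' = node_factor s v l.
Proof.
move=> AA' vv'; case: A' / AA' l' => l' /(_ erefl) ->.
by rewrite castmx_id vv'.
Qed.

(** The bound [a > q - 1] gives positivity already for an empty parent set. *)
Lemma shape_gt0 A : 0 < (a + #|A|%:R - q%:R + 1) / 2.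
Proof. by rewrite divr_gt0//; have := ler0n R #|A|; move: a_gt; lra. Qed.

Lemma mvnormal_pdf_ge0 m (mean : 'cV[R]_m) S y : 0 <= mvnormal_pdf mean S y.
Proof. by rewrite mulr_ge0 ?expR_ge0// divr_ge0 ?powR_ge0. Qed.

Lemma mvnormal_pdf_scalar_gt0 m (mean : 'cV[R]_m) v y : 0 < v ->
  0 < mvnormal_pdf mean v%:M y.
Proof.
move=> v0; have pp : 0 < 2 * pi :> R by rewrite mulr_gt0// pi_gt0.
by rewrite mvnormal_pdf_scalar// mulr_gt0 ?expR_gt0// divr_gt0 ?powR_gt0// sqrtr_gt0 exprn_gt0.
Qed.

Lemma inv_gamma_pdf_gt0 (shape rate v : R) : 0 < shape -> 0 < rate -> 0 < v ->
  0 < inv_gamma_pdf shape rate v.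
Proof.
move=> s0 r0 v0; rewrite /inv_gamma_pdf v0 mulr_gt0 ?expR_gt0//.
by rewrite mulr_gt0 ?powR_gt0// divr_gt0 ?powR_gt0 ?gamma_fun_gt0.
Qed.

Lemma inv_gamma_pdf_ge0 (shape rate v : R) : 0 < shape -> 0 < rate ->
  0 <= inv_gamma_pdf shape rate v.
Proof.
move=> s0 r0; have [v0|v0] := ltP 0 v; first exact/ltW/inv_gamma_pdf_gt0.
by rewrite /inv_gamma_pdf ltNge v0.
Qed.

Lemma node_factor_ge0 s A v (l : 'cV[R]_#|A|) : 0 <= node_factor s v l.
Proof.
apply: mulr_ge0; first by apply: mulr_ge0; exact: mvnormal_pdf_ge0.
case: ifP => // _.
by rewrite inv_gamma_pdf_ge0 ?shape_gt0 ?divr_gt0.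
Qed.

Lemma node_factor_gt0 s A v (l : 'cV[R]_#|A|) : 0 < v -> 0 < node_factor s v l.
Proof.
move=> v0; have gv0 : 0 < g^-1 * v by rewrite mulr_gt0 ?invr_gt0.
apply: mulr_gt0; first by apply: mulr_gt0; exact: mvnormal_pdf_scalar_gt0.
case: ifP => // _.
by rewrite inv_gamma_pdf_gt0 ?shape_gt0 ?divr_gt0.
Qed.

(** The prior of the variances skips the first node; the factor 1 there lets all the products range
    over the same nodes. *)
Lemma likelihood_prior_prod G (theta : params R G) :
  likelihood X theta * params_prior g a theta =
  \prod_s node_factor s (sigma2 theta s) (coef theta s).
Proof.
rewrite /likelihood /params_prior mulrCA (big_mkcond (fun s => ~~ first_node s)).
rewrite -!big_split /=.
by apply: eq_bigr => s _; rewrite mulrC /node_factor /=; congr (_ * _); case: (first_node s).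
Qed.

(** The density of column [s] given its variance [v], coefficients integrated out, times the prior
    density of [v] when the variance is random. *)
Definition node_kernel G s (v : R) : R :=
  (2 * pi) `^ (- (n%:R / 2)) *
  (Num.sqrt (\det (T_mx g G s)) / Num.sqrt (\det (Tbar_mx X g G s))) *
  (v `^ (- (n%:R / 2)) * expR (- (residual X g G s / 2 / v))) *
  (if first_node s then 1 else inv_gamma_pdf (ig_shape a G s / 2) (g / 2) v).

Lemma measurable_node_factor s A v : 0 < v ->
  measurable_fun setT (fun l : #|A|.-tuple (measurableTypeR R) =>
    node_factor s v (col_of_tuple l)).
Proof. by move=> v0; apply: measurable_funM => //; exact: measurable_ridge_density. Qed.

Lemma integral_node_factor G s v : 0 < v ->
  (\int[lebesgue_tuple R #|pa G s|]_l (node_factor s v (col_of_tuple l))%:E =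
   (node_kernel G s v)%:E)%E.
Proof.
move=> v0; rewrite /node_factor /node_kernel.
set w := (if _ then _ else _).
have w0 : 0 <= w.
  rewrite /w; case: ifP => // _.
  by rewrite inv_gamma_pdf_ge0 ?shape_gt0 ?divr_gt0.
under eq_integral do rewrite mulrC EFinM.
rewrite ge0_integralZl_EFin//; last 2 first.
- by move=> l _; rewrite lee_fin; apply: mulr_ge0; exact: mvnormal_pdf_ge0.
- by apply/measurable_EFinP; exact: measurable_ridge_density.
by rewrite integral_ridge// -EFinM mulrC.
Qed.

Lemma residual_ge0 G s : 0 <= residual X g G s.
Proof. exact: ridge_residual_ge0. Qed.

Lemma node_kernel1 G s : first_node s -> node_kernel G s 1 = node_marginal X g a G s.
Proof.
by move=> s1; rewrite /node_kernel /node_marginal s1 powR1 mul1r mulr1 divr1.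
Qed.

Lemma node_kernel_ge0 G s v : 0 <= node_kernel G s v.
Proof.
rewrite !mulr_ge0 ?powR_ge0 ?expR_ge0 ?invr_ge0 ?sqrtr_ge0//; case: ifP => // _.
by rewrite inv_gamma_pdf_ge0 ?shape_gt0 ?divr_gt0.
Qed.

Lemma node_marginal_ge0 G s : 0 <= node_marginal X g a G s.
Proof.
rewrite !mulr_ge0 ?powR_ge0 ?expR_ge0 ?invr_ge0 ?sqrtr_ge0//; case: ifP => // _.
have s0 := shape_gt0 (pa G s).
have n0 : 0 <= n%:R / 2 :> R by rewrite divr_ge0.
by rewrite !mulr_ge0 ?powR_ge0// ?invr_ge0 ltW// gamma_fun_gt0// ltr_wpDr.
Qed.

(** Conjugacy: the powers of [v] and the exponentials of prior and data merge into a kernel with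
    shape increased by [n / 2] and rate by half the residual. *)
Lemma node_kernelE G s v : 0 < v -> ~~ first_node s ->
  node_kernel G s v =
  ((2 * pi) `^ (- (n%:R / 2)) *
   (Num.sqrt (\det (T_mx g G s)) / Num.sqrt (\det (Tbar_mx X g G s))) *
   ((g / 2) `^ (ig_shape a G s / 2) / gamma_fun (ig_shape a G s / 2))) *
  inv_gamma_kernel (ig_shape a G s / 2 + n%:R / 2) ((g + residual X g G s) / 2) v.
Proof.
move=> v0 /negbTE s1; rewrite /node_kernel s1 /inv_gamma_pdf v0 /inv_gamma_kernel.
have -> : v `^ (- (ig_shape a G s / 2 + n%:R / 2) - 1) =
    v `^ (- (n%:R / 2)) * v `^ (- (ig_shape a G s / 2) - 1).
  by rewrite -gt0_powRD//; congr (_ `^ _); ring.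
have -> : expR (- ((g + residual X g G s) / 2 / v)) =
    expR (- (residual X g G s / 2 / v)) * expR (- (g / 2 / v)).
  by rewrite -expRD; congr expR; ring.
by ring.
Qed.

Lemma measurable_node_kernel G s : ~~ first_node s ->
  measurable_fun `](0:R), +oo[ (node_kernel G s).
Proof.
move=> s1; pose c := (2 * pi) `^ (- (n%:R / 2)) *
   (Num.sqrt (\det (T_mx g G s)) / Num.sqrt (\det (Tbar_mx X g G s))) *
   ((g / 2) `^ (ig_shape a G s / 2) / gamma_fun (ig_shape a G s / 2)).
pose z := ig_shape a G s / 2 + n%:R / 2; pose b := (g + residual X g G s) / 2.
apply: (eq_measurable_fun (fun v => c * inv_gamma_kernel z b v)).
  by move=> v; rewrite inE/= in_itv/= andbT => v0; rewrite node_kernelE.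
apply: measurable_funM => //; exact: measurable_inv_gamma_kernel.
Qed.

Lemma integral_node_kernel G s : ~~ first_node s ->
  (\int[mu]_(v in `]0%R, +oo[) (node_kernel G s v)%:E =
   (node_marginal X g a G s)%:E)%E.
Proof.
move=> s1.
have a0 := shape_gt0 (pa G s).
have n0 : 0 <= n%:R / 2 :> R by rewrite divr_ge0.
set z := ig_shape a G s / 2 + n%:R / 2; set b := (g + residual X g G s) / 2.
have z0 : 0 < z by rewrite ltr_wpDr.
(* The updated rate is positive because the residual is nonnegative. *)
have b0 : 0 < b by rewrite divr_gt0// ltr_wpDr// residual_ge0.
under eq_integral => v.
  rewrite inE/= in_itv/= andbT => v0; rewrite node_kernelE// EFinM; over.
rewrite ge0_integralZl_EFin//; last 3 first.
- by move=> v _; rewrite lee_fin mulr_ge0 ?powR_ge0 ?expR_ge0.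
- by apply/measurable_EFinP; exact: measurable_inv_gamma_kernel.
- by rewrite !mulr_ge0 ?powR_ge0 ?invr_ge0 ?sqrtr_ge0// ltW// gamma_fun_gt0.
rewrite integral_inv_gamma_kernel// -EFinM /node_marginal (negbTE s1); congr (_%:E).
have -> : - ((ig_shape a G s + n%:R) / 2) = - z by rewrite /z; ring.
by rewrite -/z -/b; ring.
Qed.
End node_factor.

(** * The acceptance ratio *)

Section int_params.
Variables (R : realType) (q n : nat) (X : 'M[R]_(n, q)) (g a : R).
Hypothesis g_gt0 : 0 < g.
Hypothesis a_gt : q%:R - 1 < a.
Variable G : digraph q.
Implicit Types (s t : 'I_q) (theta : params R G) (r : seq 'I_q).
Local Notation mu := (@lebesgue_measure R).

Definition factor theta s : R :=
  node_factor X g a s (sigma2 theta s) (coef theta s).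

(** Unlike [admissible], this survives [set_variance] at any node but the first, whatever the new
    value, so it can be carried through the iterated integral. *)
Definition first_variance1 theta := forall s, first_node s -> sigma2 theta s = 1.

Lemma factor_set_coef theta s (l : 'cV[R]_#|pa G s|) t :
  factor (set_coef theta l) t =
  if t == s then node_factor X g a s (sigma2 theta s) l else factor theta t.
Proof.
rewrite /factor /set_coef /=; case: eqVneq => [->|ts]; first by rewrite dfwithin.
by rewrite dfwithout// eq_sym.
Qed.

(** Only the factor of [s] involves [L_s], so the others leave the integral. The constant [c] is
    meant for the marginals of nodes already integrated. *)
Lemma int_coef_factor s (Q : pred 'I_q) c theta : 0 <= c -> 0 < sigma2 theta s -> Q s ->
  int_coef s (fun th => (\prod_(t | Q t) factor th t * c)%:E) theta =
  ((\prod_(t | Q t && (t != s)) factor theta t * c) *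
     node_kernel X g a G s (sigma2 theta s))%:E.
Proof.
move=> c0 v0 Qs; set K := \prod_(t | _) _ * c.
have K0 : 0 <= K by rewrite mulr_ge0// prodr_ge0// => t _; exact: node_factor_ge0.
transitivity (\int[lebesgue_tuple R #|pa G s|]_l
    (K%:E * (node_factor X g a s (sigma2 theta s) (col_of_tuple l))%:E))%E.
  apply: eq_integral => l _; rewrite -EFinM (bigD1 s)//= factor_set_coef eqxx.
  rewrite (eq_bigr (factor theta)); first by rewrite -mulrA mulrC.
  by move=> t /andP[_ /negbTE ts]; rewrite factor_set_coef ts.
rewrite ge0_integralZl_EFin//.
- by rewrite integral_node_factor// -EFinM.
- by move=> l _; rewrite lee_fin node_factor_ge0.
- by apply/measurable_EFinP; exact: measurable_node_factor.
Qed.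

(** Induction on the list: the tail is integrated innermost and has already produced its marginals;
    then come the coefficients of the head, and last its variance. *)
Lemma int_params_factor r theta : uniq r -> first_variance1 theta ->
  foldr (fun s F => int_variance s (int_coef s F))
    (fun th => (\prod_t factor th t)%:E) r theta =
  (\prod_(t | t \notin r) factor theta t *
   \prod_(s <- r) node_marginal X g a G s)%:E.
Proof.
elim: r theta => [|s r IH] theta /=.
  by move=> _ _; rewrite big_nil mulr1.
move=> /andP[sr ur] th1; set F' := foldr _ _ _.
pose c := \prod_(s <- r) node_marginal X g a G s.
have c0 : 0 <= c by apply: prodr_ge0 => t _; exact: node_marginal_ge0.
pose Q := [pred t | t \notin r].
(* Both uses supply a positive variance: it is 1 at the first node, and elsewhere it ranges over the
   domain of the outer integral. *)
have coefE th : first_variance1 th -> 0 < sigma2 th s -> int_coef s F' th =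
    ((\prod_(t | t \notin s :: r) factor th t * c) *
       node_kernel X g a G s (sigma2 th s))%:E.
  move=> thv v0; transitivity (int_coef s (fun th => (\prod_(t | Q t) factor th t * c)%:E) th).
    by apply: eq_integral => l _; rewrite /F' IH.
  rewrite int_coef_factor//; congr (_ * _ * _)%:E; apply: eq_bigl => t.
  by rewrite inE negb_or andbC.
rewrite big_cons /int_variance; case: ifP => s1.
  rewrite coefE ?th1// node_kernel1//; congr (_%:E); rewrite -/c; ring.
(* The factors of the other nodes do not involve the variance of [s], hence are constants of the
   outer integral. *)
have fE v : \prod_(t | t \notin s :: r) factor (set_variance theta s v) t =
    \prod_(t | t \notin s :: r) factor theta t.
  apply: eq_bigr => t; rewrite inE negb_or => /andP[/negbTE ts _].
  by rewrite /factor /set_variance /= ts.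
have v1 v : first_variance1 (set_variance theta s v).
  move=> t t1 /=; case: eqVneq => [ts|_]; last exact: th1.
  by rewrite -ts t1 in s1.
under eq_integral => v.
  rewrite inE/= in_itv/= andbT => v0.
  by rewrite coefE//= ?eqxx// fE EFinM; over.
rewrite ge0_integralZl_EFin//.
- rewrite integral_node_kernel ?s1// -EFinM; congr (_%:E); rewrite -/c; ring.
- by move=> v _; rewrite lee_fin node_kernel_ge0.
- by apply/measurable_EFinP; apply: measurable_node_kernel; rewrite s1.
- rewrite mulr_ge0// prodr_ge0// => t _; exact: node_factor_ge0.
Qed.

Lemma dag_posterior_pair xi c (i j : 'I_q) theta : i != j -> first_variance1 theta ->
  dag_posterior X g a xi c [set i; j]%SET theta =
  c * (dag_prior xi G * (\prod_(t | t \notin [set i; j]%SET) factor theta t *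
    (node_marginal X g a G i * node_marginal X g a G j))).
Proof.
move=> ij th1; rewrite /dag_posterior /int_params.
have -> : (fun th : params R G => (likelihood X th * params_prior g a th)%:E) =
    (fun th => (\prod_t factor th t)%:E).
  by apply/funext => th; rewrite likelihood_prior_prod.
rewrite int_params_factor ?enum_uniq//= big_enum/= big_setU1 ?inE//= big_set1.
by congr (_ * (_ * (_ * _))); apply: eq_bigl => t; rewrite mem_enum.
Qed.
End int_params.

(** Here [k] is the product of the factors common to both graphs and [c] the proportionality
    constant; the rest is regrouping of fractions, valid with [0^-1 = 0]. *)
Lemma ratio_cancel (F : fieldType) (c k m m' p p' r r' : F) : c != 0 -> k != 0 ->
  (c * (p' * (k * m')) * r') / (c * (p * (k * m)) * r) =
  m' / m * (p' / p) * (r' / r).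
Proof.
move=> c0 k0; rewrite (_ : _ * r' = (c * k) * (m' * p' * r')); last by ring.
rewrite (_ : _ * r = (c * k) * (m * p * r)); last by ring.
by rewrite -mulf_div divff ?mul1r ?mulf_neq0// !mulf_div.
Qed.

Theorem mainTheorem2 (R : realType) (q n : nat) (q_ge1 : (1 <= q)%N)
    (n_ge1 : (1 <= n)%N) (X : 'M[R]_(n, q)) (g a xi : R) (g_gt0 : 0 < g)
    (a_gt : q%:R - 1 < a) (xi_in : 0 < xi < 1)
    (D D' : digraph q) (D_dag : is_dag D) (D'_dag : is_dag D')
    (i j : 'I_q) (Dij : edge D i j) (D'E : D' = reverse_edge D i j)
    (theta : params R D) (theta' : params R D')
    (theta_adm : admissible theta) (theta'_adm : admissible theta')
    (same : same_outside (changed_nodes D D') theta theta')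
    (c : R) (c_gt0 : 0 < c) :
  pas_acceptance X g a xi c theta theta' =
  Num.min 1
    ((node_marginal X g a D' i * node_marginal X g a D' j) /
       (node_marginal X g a D i * node_marginal X g a D j) *
     (dag_prior xi D' / dag_prior xi D) *
     (proposal R D D' / proposal R D' D)).
Proof.
have UE : changed_nodes D D' = [set i; j]%SET by rewrite D'E changed_nodes_reverse.
(* An edge from a node to itself would be closed by the empty path. *)
have ij : i != j.
  apply: contraTneq Dij => <-; apply/negP => Dii.
  by move: D_dag => /forallP/(_ i)/forallP/(_ i); rewrite Dii connect0.
have adm1 G (th : params R G) : admissible th -> first_variance1 th.
  by move=> h s; case: (h s).
(* Outside [i] and [j] the parent sets agree and the parameters coincide up to the cast. *)
have outE : \prod_(t | t \notin [set i; j]%SET) factor X g a theta' t =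
    \prod_(t | t \notin [set i; j]%SET) factor X g a theta t.
  rewrite -UE; apply: eq_bigr => t tU; have [sE cE] := same t tU.
  apply: node_factor_castmx => //.
  by move: tU; rewrite inE negbK => /eqP.
rewrite /pas_acceptance UE !dag_posterior_pair//; [|exact: adm1|exact: adm1].
rewrite outE; set K := \prod_(t | _) _.
(* Admissible variances are positive, so each common factor is a positive density value and may be
   cancelled. *)
have K0 : K != 0.
  rewrite gt_eqF// prodr_gt0// => t _; apply: node_factor_gt0 => //.
  by case: (theta_adm t).
by congr (Num.min _ _); apply: ratio_cancel => //; rewrite gt_eqF.
Qed.
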